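(* Let $m\ge 2$, $n\ge 1$ and let $\mathcal{A}$ be a real $m$-order $n$-dimensional symmetric tensor. Then $\mathcal{A}$ has at least one Pareto $H$-eigenvalue, namely $$\gamma(\mathcal{A})=\min\{\mathcal{A}x^m:\ x\in\mathbb{R}^n,\ x\ge 0,\ \|x\|_m=1\}$$ is a Pareto $H$-eigenvalue of $\mathcal{A}$.
   Context: An $m$-order $n$-dimensional real tensor is an array $\mathcal{A}=(a_{i_1\cdots i_m})$ of real numbers, $i_1,\ldots,i_m\in\{1,\ldots,n\}$; it is symmetric if its entries are invariant under any permutation of the indices. For $x\in\mathbb{R}^n$, $\mathcal{A}x^m=\sum_{i_1,\ldots,i_m=1}^n a_{i_1\cdots i_m}x_{i_1}\cdots x_{i_m}$, and $\mathcal{A}x^{m-1}\in\mathbb{R}^n$ is the vector with components $(\mathcal{A}x^{m-1})_i=\sum_{i_2,\ldots,i_m=1}^n a_{ii_2\cdots i_m}x_{i_2}\cdots x_{i_m}$. Write $x^{[m-1]}=(x_1^{m-1},\ldots,x_n^{m-1})^T$ and $\|x\|_m=(|x_1|^m+\cdots+|x_n|^m)^{1/m}$. Vector inequalities are componentwise. A real number $\lambda$ is a Pareto $H$-eigenvalue of $\mathcal{A}$ if there is a non-zero $x\in\mathbb{R}^n$ with $\mathcal{A}x^m=\lambda x^Tx^{[m-1]}$, $\mathcal{A}x^{m-1}-\lambda x^{[m-1]}\ge 0$ and $x\ge 0$. *)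

(* Defs.v *)
From HB Require Import structures.
From mathcomp Require Import all_boot all_order all_algebra all_fingroup.
From mathcomp Require Import classical_sets reals exp.

Set Implicit Arguments.
Unset Strict Implicit.
Unset Printing Implicit Defensive.

Import Order.TTheory GRing.Theory Num.Theory.

Local Open Scope ring_scope.

Definition tensor (R : realType) (m n : nat) := {ffun m.-tuple 'I_n -> R}.

Definition symmetric_tensor (R : realType) (m n : nat) (A : tensor R m n) : Prop :=
  forall (s : 'S_m) (t : m.-tuple 'I_n), A [tuple tnth t (s k) | k < m] = A t.

Definition tensor_form (R : realType) (m n : nat) (A : tensor R m n)
    (x : 'cV[R]_n) : R :=
  \sum_(t : m.-tuple 'I_n) A t * \prod_(j <- t) x j 0.

(* The pairs (i, (i_2, ..., i_m)) are the m-tuples t whose first entry is i,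
   and (i_2, ..., i_m) is then [behead t]; this keeps m itself as the order of
   A. For m = 0 the sum is empty. *)
Definition tensor_vec (R : realType) (m n : nat) (A : tensor R m n)
    (x : 'cV[R]_n) : 'cV[R]_n :=
  \col_(i < n) \sum_(t : m.-tuple 'I_n | ohead t == Some i)
                 A t * \prod_(j <- behead t) x j 0.

Definition vec_exp (R : realType) (n : nat) (x : 'cV[R]_n) (k : nat) : 'cV[R]_n :=
  map_mx (fun a => a ^+ k) x.

Definition vec_nonneg (R : realType) (n : nat) (x : 'cV[R]_n) : Prop :=
  forall i, 0 <= x i 0.

(* The canonical norm `|x| of MathComp-Analysis on matrices is the sup norm. *)
Definition lnorm (R : realType) (n : nat) (m : nat) (x : 'cV[R]_n) : R :=
  (\sum_(i < n) `|x i 0| ^+ m) `^ (m%:R^-1).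

Definition pareto_H_eigenvalue (R : realType) (m n : nat) (A : tensor R m n)
    (lambda : R) : Prop :=
  exists x : 'cV[R]_n,
    [/\ x != 0,
        tensor_form A x = lambda * (x^T *m vec_exp x m.-1) 0 0,
        vec_nonneg (tensor_vec A x - lambda *: vec_exp x m.-1)
      & vec_nonneg x].

Definition pareto_values (R : realType) (m n : nat) (A : tensor R m n) : set R :=
  [set tensor_form A x | x in
     [set x : 'cV[R]_n | vec_nonneg x /\ lnorm m x = 1]]%classic.

Definition is_min (R : realType) (S : set R) (g : R) : Prop :=
  S g /\ lbound S g.

(* Main.v *)
Require Import Defs.
From mathcomp Require Import all_boot all_order all_algebra all_fingroup.
From mathcomp Require Import classical_sets reals exp topology normedtype.
From mathcomp Require Import derive realfun.

(** A minimiser [x] on the compact set [{x >= 0, \sum x_i ^ m = 1}] exists by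
    continuity.  By homogeneity [y |-> A y^m - gamma * \sum y_j ^ m] is
    nonnegative on the whole nonnegative orthant and vanishes at [x], so at [x]
    its one-sided derivative in each direction [e_i] is nonnegative; by symmetry
    of [A] that derivative is [m ((A x^(m-1))_i - gamma x_i^(m-1))]. *)

Set Implicit Arguments.
Unset Strict Implicit.
Unset Printing Implicit Defensive.

Import Order.TTheory GRing.Theory Num.Theory.
Import numFieldNormedType.Exports.

Local Open Scope ring_scope.

(** * Linear coefficients of polynomials as derivatives at 0 *)

Lemma prod_neq_lift0 (R : comNzRingType) (m : nat) (F : 'I_m.+1 -> R)
    (k : 'I_m) :
  \prod_(l | l != lift ord0 k) F l = F ord0 * \prod_(l | l != k) F (lift ord0 l).
Proof.
by rewrite big_mkcond big_ord_recl /= [in RHS]big_mkcond; congr (_ * _).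
Qed.

Lemma prod_neq0 (R : comNzRingType) (m : nat) (F : 'I_m.+1 -> R) :
  \prod_(l | l != ord0) F l = \prod_(l < m) F (lift ord0 l).
Proof. by rewrite big_mkcond big_ord_recl /= mul1r. Qed.

(** The product rule at 0: the coefficient of degree 1 is the derivative at 0 and that of degree 0
    the value, so differentiation becomes pure algebra. *)
Lemma coef1_prod (R : comNzRingType) (m : nat) (F : 'I_m -> {poly R}) :
  (\prod_k F k)`_1 = \sum_k (F k)`_1 * \prod_(l | l != k) (F l)`_0.
Proof.
elim: m F => [|m IH] F; first by rewrite !big_ord0 coef1.
rewrite !big_ord_recl coefM !big_ord_recl big_ord0 addr0 /= addrC.
rewrite coef0_prod prod_neq0; congr (_ + _).
rewrite IH mulr_sumr; apply: eq_bigr => k _.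
by rewrite (prod_neq_lift0 (fun l => (F l)`_0)) mulrCA.
Qed.

Lemma coef1_exp (R : comNzRingType) (p : {poly R}) (m : nat) :
  (p ^+ m)`_1 = m%:R * (p`_1 * p`_0 ^+ m.-1).
Proof.
have -> : p ^+ m = \prod_(k < m) p by rewrite prodr_const card_ord.
rewrite coef1_prod (eq_bigr (fun=> p`_1 * p`_0 ^+ m.-1)); last first.
  by move=> k _; rewrite prodr_const cardC1 card_ord.
by rewrite sumr_const card_ord mulr_natl.
Qed.

(** Dividing by the variable gives [q] with [p.[s] = q.[s] * s]; [q] is nonnegative to the right of
    0, hence so is its limit [q.[0]], the linear coefficient of [p]. *)
Lemma coef1_ge0 (R : realType) (p : {poly R}) :
  p`_0 = 0 -> (forall s, 0 < s -> 0 <= p.[s]) -> 0 <= p`_1.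
Proof.
move=> p0 pge0; pose q := drop_poly 1 p.
have pE s : p.[s] = q.[s] * s.
  rewrite -{1}(poly_take_drop 1 p) hornerD hornerM hornerXn expr1 -/q.
  by rewrite /take_poly horner_poly big_ord_recl big_ord0 /= p0 mul0r !add0r.
have -> : p`_1 = q.[0] by rewrite horner_coef0 coef_drop_poly.
have qc : (q.[s] @[s --> 0^'+] --> q.[0])%classic.
  by apply: cvg_at_right_filter; apply: continuous_horner.
have qge : (\forall s \near 0^'+, 0 <= q.[s])%classic.
  near=> s; have s0 : 0 < s by near: s; exact: nbhs_right_gt.
  by have := pge0 s s0; rewrite pE pmulr_lge0.
by rewrite -(cvg_lim (@Rhausdorff R) qc); apply: limr_ge => //; apply: cvgP qc.
Unshelve. all: by end_near. Qed.

(** * Homogeneity and perturbation of the form along a coordinate direction *)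

Section TensorForm.
Variables (R : realType) (n : nat).

Lemma tensor_formZ (m : nat) (A : tensor R m n) (c : R) (x : 'cV[R]_n) :
  tensor_form A (c *: x) = c ^+ m * tensor_form A x.
Proof.
rewrite /tensor_form mulr_sumr; apply: eq_bigr => t _.
under eq_bigr do rewrite mxE.
by rewrite big_split /= big_const_seq count_predT size_tuple -Monoid.iteropE
  /= mulrCA.
Qed.

(* The polynomial [s |-> (x + s e_i)_j]. *)
Definition pert (x : 'cV[R]_n) (i j : 'I_n) : {poly R} :=
  (x j 0)%:P + (j == i)%:R *: 'X.

Lemma pert_coef0 (x : 'cV[R]_n) (i j : 'I_n) : (pert x i j)`_0 = x j 0.
Proof. by rewrite coefD coefC coefZ coefX mulr0 addr0. Qed.

Lemma pert_coef1 (x : 'cV[R]_n) (i j : 'I_n) : (pert x i j)`_1 = (j == i)%:R.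
Proof. by rewrite coefD coefC coefZ coefX mulr1 add0r. Qed.

Lemma horner_pert (x : 'cV[R]_n) (i j : 'I_n) (s : R) :
  (pert x i j).[s] = (x + s *: delta_mx i 0) j 0.
Proof. by rewrite !mxE eqxx andbT hornerD hornerC hornerZ hornerX mulrC. Qed.

Definition form_pert (m : nat) (A : tensor R m n) (x : 'cV[R]_n) (i : 'I_n) :
    {poly R} := \sum_(t : m.-tuple 'I_n) A t *: \prod_(j <- t) pert x i j.

Lemma horner_form_pert (m : nat) (A : tensor R m n) (x : 'cV[R]_n) (i : 'I_n)
    (s : R) :
  (form_pert A x i).[s] = tensor_form A (x + s *: delta_mx i 0).
Proof.
rewrite /form_pert horner_sum; apply: eq_bigr => t _.
rewrite hornerZ horner_prod; congr (_ * _); apply: eq_bigr => j _.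
exact: horner_pert.
Qed.

(** Turning the condition on the first index into an indicator factor gives exactly the position 0
    term of the product rule. *)
Lemma tensor_vecE (m : nat) (A : tensor R m.+1 n) (x : 'cV[R]_n) (i : 'I_n) :
  tensor_vec A x i 0 = \sum_t A t * ((tnth t ord0 == i)%:R *
    \prod_(l | l != ord0) x (tnth t l) 0).
Proof.
rewrite mxE big_mkcond; apply: eq_bigr => t _; case/tupleP: t => h t.
rewrite tnth0 /= (inj_eq (@Some_inj _)).
case: eqP => _; last by rewrite mul0r mulr0.
rewrite mul1r (prod_neq0 (fun l => x (tnth [tuple of h :: t] l) 0)).
rewrite big_tuple; congr (_ * _); apply: eq_bigr => l _.
by rewrite tnthS.
Qed.

(* Swapping positions [k] and [0] in the index tuple is harmless by symmetry, so
   all [m] terms of the product rule contribute equally. *)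
Lemma form_pert_coef1 (m : nat) (A : tensor R m n) (x : 'cV[R]_n) (i : 'I_n) :
  symmetric_tensor A -> (form_pert A x i)`_1 = m%:R * tensor_vec A x i 0.
Proof.
case: m A => [|m] A hA.
  rewrite mul0r /form_pert coef_sum big1 // => t _.
  by rewrite tuple0 big_nil coefZ coef1 mulr0.
pose G (k : 'I_m.+1) (t : m.+1.-tuple 'I_n) :=
  (tnth t k == i)%:R * \prod_(l | l != k) x (tnth t l) 0.
have -> : (form_pert A x i)`_1 = \sum_t \sum_k A t * G k t.
  rewrite /form_pert coef_sum; apply: eq_bigr => t _.
  rewrite coefZ big_tuple coef1_prod mulr_sumr; apply: eq_bigr => k _.
  rewrite pert_coef1; congr (_ * (_ * _)); apply: eq_bigr => l _.
  exact: pert_coef0.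
rewrite exchange_big /= tensor_vecE -/(G ord0).
rewrite (eq_bigr (fun=> \sum_t A t * G ord0 t)); last first.
  move=> k _; pose s := tperm k ord0.
  pose sw (t : m.+1.-tuple 'I_n) := [tuple tnth t (s l) | l < m.+1].
  have swK : involutive sw.
    by move=> t; apply: eq_from_tnth => l; rewrite !tnth_mktuple tpermK.
  rewrite (reindex_inj (inv_inj swK)); apply: eq_bigr => t _.
  rewrite hA; congr (_ * _); rewrite /G tnth_mktuple tpermL; congr (_ * _).
  (* The same transposition, applied to the product, moves the omitted position from [k] to 0. *)
  rewrite (reindex_inj (@perm_inj _ s)); apply: eq_big => l.
    by rewrite -(inj_eq (@perm_inj _ s)) /s tpermK tpermL.
  by rewrite tnth_mktuple tpermK.
by rewrite sumr_const card_ord mulr_natl.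
Qed.

(** * Existence of a minimiser on the unit sphere of the orthant *)

Lemma lnormX (m : nat) (x : 'cV[R]_n) : (0 < m)%N ->
  lnorm m x ^+ m = \sum_(i < n) `|x i 0| ^+ m.
Proof.
move=> m0; rewrite /lnorm -powR_mulrn ?powR_ge0 // -powRrM mulVf.
  by rewrite powRr1 // sumr_ge0 // => i _; apply: exprn_ge0.
by rewrite pnatr_eq0 -lt0n.
Qed.

Lemma lnorm_eq1 (m : nat) (x : 'cV[R]_n) : (0 < m)%N ->
  lnorm m x = 1 <-> \sum_(i < n) `|x i 0| ^+ m = 1.
Proof.
move=> m0; split=> [e|e]; first by rewrite -lnormX // e expr1n.
by rewrite /lnorm e powR1.
Qed.

Lemma sum_norm_nonneg (m : nat) (x : 'cV[R]_n) : vec_nonneg x ->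
  \sum_(i < n) `|x i 0| ^+ m = \sum_(i < n) x i 0 ^+ m.
Proof. by move=> x0; apply: eq_bigr => i _; rewrite ger0_norm. Qed.

(** Row vectors are used because [rV_compact] provides compact boxes for them. *)
Lemma continuous_tensor_form (m : nat) (A : tensor R m n) :
  continuous (fun v : 'rV[R]_n => tensor_form A v^T).
Proof.
have cj j : continuous (fun v : 'rV[R]_n => v^T j 0).
  under boolp.eq_fun do rewrite mxE.
  exact: coord_continuous.
have cp (t : m.-tuple 'I_n) :
    continuous (fun v : 'rV[R]_n => \prod_(j <- t) v^T j 0).
  by apply: continuous_big => //; exact: mul_continuous.
apply: continuous_big; first exact: add_continuous.
move=> t _ v.
apply: (@continuousM R 'rV[R]_n (fun=> A t) _ v _ (cp t v)).
exact: cst_continuous.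
Qed.

Lemma continuous_sum_exp (m : nat) :
  continuous (fun v : 'rV[R]_n => \sum_(i < n) v 0 i ^+ m).
Proof.
apply: continuous_big; first exact: add_continuous.
move=> i _ v.
apply: (@continuous_comp 'rV[R]_n R R (fun v => v 0 i) (fun a => a ^+ m)).
  exact: coord_continuous.
exact: exprn_continuous.
Qed.

(** The feasible set is, up to transposition, a closed subset [C] of the compact box [B], so the
    extreme value theorem applies. *)
Lemma pareto_values_min (m : nat) (A : tensor R m n) :
  (0 < m)%N -> (0 < n)%N ->
  exists x : 'cV[R]_n, [/\ vec_nonneg x, lnorm m x = 1 &
    forall y, vec_nonneg y -> lnorm m y = 1 ->
      tensor_form A x <= tensor_form A y].
Proof.
move=> m0 n0.
pose B : set 'rV[R]_n :=
  [set v | forall i, [set` `[0, 1]%R]%classic (v ord0 i)]%classic.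
pose C : set 'rV[R]_n := [set v | \sum_(i < n) v 0 i ^+ m = 1]%classic.
have BC x : vec_nonneg x -> lnorm m x = 1 -> (B `&` C)%classic x^T.
  move=> x0 /(lnorm_eq1 _ m0); rewrite sum_norm_nonneg // => x1; split=> [i|].
    (* Each [x i 0 ^+ m] is one term of a nonnegative sum equal to 1, so each entry is at most 1. *)
    rewrite /= in_itv /= mxE x0 /= -(expr_le1 m0) // -x1 (bigD1 i) //= lerDl.
    by apply: sumr_ge0 => j _; apply: exprn_ge0.
  by rewrite /C /= -[RHS]x1; apply: eq_bigr => i _; rewrite mxE.
have Cl : closed C.
  apply: (@preimage_closed 'rV[R]_n R _ [set y | y = 1]%classic).
    by move=> v _; exact: (@continuous_sum_exp m v).
  exact: closed_eq.
have cBC : compact (B `&` C)%classic.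
  apply: compact_closedI => //.
  apply: (@rV_compact R n (fun=> [set` `[0, 1]%R]%classic)) => i.
  exact: segment_compact.
have [|v] := compact_EVT_min _ cBC
    (continuous_subspaceT (@continuous_tensor_form m A)).
  (* The first basis vector shows that the feasible set is nonempty. *)
  pose e := delta_mx (Ordinal n0) 0 : 'cV[R]_n; exists e^T; apply: BC.
    by move=> i; rewrite mxE ler0n.
  apply/(lnorm_eq1 _ m0); rewrite (bigD1 (Ordinal n0)) //= big1 => [|i ni].
    by rewrite mxE !eqxx normr1 expr1n addr0.
  by rewrite mxE (negbTE ni) normr0 expr0n eqn0Ngt m0.
rewrite inE => -[vB vC] vmin; exists v^T.
have v0 : vec_nonneg v^T.
  by move=> i; rewrite mxE; have /= := vB i; rewrite in_itv /= => /andP[].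
split=> // [|y y0 y1].
  apply/(lnorm_eq1 _ m0); rewrite sum_norm_nonneg // -[RHS]vC.
  by apply: eq_bigr => i _; rewrite mxE.
by rewrite -[y]trmxK; apply: vmin; rewrite inE; apply: BC.
Qed.

(** * First-order conditions at the minimiser *)

(** Both sides are homogeneous of degree [m], so a nonzero [y] can be rescaled to the unit
    sphere. *)
Lemma tensor_form_lower_bound (m : nat) (A : tensor R m n) (g : R) :
  (0 < m)%N ->
  (forall y, vec_nonneg y -> lnorm m y = 1 -> g <= tensor_form A y) ->
  forall y, vec_nonneg y -> g * \sum_(i < n) y i 0 ^+ m <= tensor_form A y.
Proof.
move=> m0 gmin y y0; set S := \sum_(i < n) _.
have Sge : 0 <= S by apply: sumr_ge0 => i _; apply: exprn_ge0.
have [S0|Sn0] := eqVneq S 0.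
  (* A zero power sum forces [y] to vanish; in this shape homogeneity evaluates the form to
     [0 ^+ m = 0]. *)
  have -> : y = 0 *: y.
    apply/matrixP => i j; rewrite scale0r mxE ord1; apply/eqP.
    have /eqP := psumr_eq0P (fun k _ => exprn_ge0 m (y0 k)) S0 (erefl (xpredT i)).
    by rewrite expf_eq0 m0.
  by rewrite tensor_formZ S0 mulr0 expr0n eqn0Ngt m0 mul0r.
have Spos : 0 < S by rewrite lt_neqAle eq_sym Sn0.
pose c := (lnorm m y)^-1.
have cS : c ^+ m = S^-1 by rewrite /c exprVn lnormX // sum_norm_nonneg.
have cy0 : vec_nonneg (c *: y).
  by move=> i; rewrite mxE mulr_ge0 // invr_ge0 powR_ge0.
have /gmin : lnorm m (c *: y) = 1.
  apply/(lnorm_eq1 _ m0); rewrite sum_norm_nonneg //.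
  under eq_bigr do rewrite mxE exprMn.
  by rewrite -mulr_sumr cS mulVf.
by move=> /(_ cy0); rewrite tensor_formZ cS mulrC ler_pdivlMr.
Qed.

Lemma tensor_vec_min (m : nat) (A : tensor R m n) (g : R) (x : 'cV[R]_n) :
  (0 < m)%N -> symmetric_tensor A -> vec_nonneg x ->
  (forall y, vec_nonneg y -> g * \sum_(i < n) y i 0 ^+ m <= tensor_form A y) ->
  tensor_form A x = g * \sum_(i < n) x i 0 ^+ m ->
  vec_nonneg (tensor_vec A x - g *: vec_exp x m.-1).
Proof.
move=> m0 hA x0 lb xE i.
pose p := form_pert A x i - g *: \sum_(j < n) pert x i j ^+ m.
have pE s : p.[s] = tensor_form A (x + s *: delta_mx i 0)
    - g * \sum_(j < n) (x + s *: delta_mx i 0) j 0 ^+ m.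
  rewrite hornerD horner_form_pert hornerN hornerZ horner_sum.
  by congr (_ - _ * _); apply: eq_bigr => j _; rewrite horner_exp horner_pert.
(* Only coordinate [i] moves, so the power sum contributes the single linear coefficient
   [m x_i^(m-1)]. *)
have p1 : p`_1 = m%:R * (tensor_vec A x - g *: vec_exp x m.-1) i 0.
  rewrite coefB form_pert_coef1 // coefZ coef_sum (bigD1 i) //= big1 ?addr0.
    rewrite coef1_exp pert_coef1 pert_coef0 eqxx mul1r.
    by rewrite !mxE mulrBr mulrCA.
  by move=> j ji; rewrite coef1_exp pert_coef1 (negbTE ji) mul0r mulr0.
rewrite -(pmulr_rge0 _ (x := m%:R)) ?ltr0n // -p1; apply: coef1_ge0.
  (* Equality in the lower bound at [x] makes [p] vanish at 0. *)
  by rewrite -horner_coef0 pE scale0r addr0 xE subrr.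
move=> s s0; rewrite pE subr_ge0; apply: lb => j.
by rewrite !mxE addr_ge0 // mulr_ge0 // ?ler0n // ltW.
Qed.

End TensorForm.

Theorem theorem4p2 (R : realType) (m n : nat) (hm : (2 <= m)%N) (hn : (1 <= n)%N)
    (A : tensor R m n) (hA : symmetric_tensor A) :
  exists gamma : R, is_min (pareto_values A) gamma /\ pareto_H_eigenvalue A gamma.
Proof.
have m0 : (0 < m)%N by apply: ltnW.
have [x [x0 x1 xmin]] := pareto_values_min A m0 hn.
exists (tensor_form A x); split; first split; first by exists x.
  by move=> _ [y [y0 y1] <-]; apply: xmin.
have xS : \sum_(i < n) x i 0 ^+ m = 1.
  by rewrite -sum_norm_nonneg //; apply/lnorm_eq1.
exists x; split=> //.
- apply/eqP => xz; move: xS; rewrite xz big1 => [/eqP|i _].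
    by rewrite eq_sym oner_eq0.
  by rewrite mxE expr0n eqn0Ngt m0.
(* Here [x^T x^[m-1]] is the power sum of [x], which is 1, and the eigenvalue is [tensor_form A x]
   itself. *)
- rewrite mxE (eq_bigr (fun i => x i 0 ^+ m)) ?xS ?mulr1 // => i _.
  by rewrite !mxE -exprS prednK.
- apply: tensor_vec_min => //; last by rewrite xS mulr1.
  exact: tensor_form_lower_bound.
Qed.
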